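(* Let $f,h,A,\mathcal{L},\mathscr{L},\alpha,L,M$ be as in the context, assume conditions (A1)–(A4) of the context, and let $\{(x^k,y^k)\}_{k\ge 0}$ be a sequence generated by the PPDG iteration with stepsize $\alpha>0$ and $M=\alpha AA^T$, where $\alpha$ and $\delta>0$ are such that the constants $a,b,c$ of the context are positive. Suppose that $\mathscr{L}$ is a Kurdyka-Łojasiewicz (KL) function and that $\{(x^k,y^k)\}$ is bounded. Then $(x^k,y^k)$ converges to a critical point of $\mathcal{L}$ (an element of $\mathrm{crit}\,\mathcal{L}$), and $$\sum_{k=1}^{\infty}\|x^{k+1}-x^k\|<\infty,\qquad \sum_{k=1}^{\infty}\|y^{k+1}-y^k\|<\infty.$$
   Context: Setting. $\mathbb{X},\mathbb{Y}$ are finite-dimensional real inner product spaces with duals $\mathbb{X}^*,\mathbb{Y}^*$ (identified with $\mathbb{X},\mathbb{Y}$ via the inner products); $f:\mathbb{X}\to\mathbb{R}$ is continuously differentiable (possibly nonconvex), $A:\mathbb{X}\to\mathbb{Y}$ is linear with adjoint $A^T$, and $h:\mathbb{Y}\to(-\infty,+\infty]$ is possibly nonsmooth and nonconvex. The conjugate is $h^*(y)=\sup_{u\in\mathbb{Y}}\{\langle y,u\rangle-h(u)\}$, a convex lower semicontinuous function with convex subdifferential $\partial h^*$. Define $\mathcal{L}(x,y):=f(x)+\langle y,Ax\rangle-h^*(y)$ on $\mathbb{X}\times\mathbb{Y}^*$, $\partial\mathcal{L}(x,y):=\{\nabla f(x)+A^Ty\}\times(Ax-\partial h^*(y))$, and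 $\mathrm{crit}\,\mathcal{L}:=\{(x,y):0\in\partial\mathcal{L}(x,y)\}$. Assumptions. (A1) there is $L>0$ with $\|\nabla f(x)-\nabla f(z)\|\le L\|x-z\|$ for all $x,z\in\mathbb{X}$. (A2) $\inf_{x\in\mathbb{X}}\mathcal{L}(x,y)>-\infty$ for every $y\in\mathbb{Y}^*$. (A3) $A$ is surjective. (A4) the convex hull of the function $h$ is proper. PPDG iteration. Given $(x^0,y^0)\in\mathbb{X}\times\mathbb{Y}^*$, $\alpha>0$ and $M=\alpha AA^T$ (positive definite), for $k\ge0$: $x^{k+1}=x^k-\alpha(\nabla f(x^k)+A^Ty^k)$, and $y^{k+1}=\mathrm{prox}^{M}_{h^*}\big(y^k+M^{-1}A(2x^{k+1}-x^k)\big)$, where $\mathrm{prox}^M_{h^*}(w)=\arg\min_{y}\{h^*(y)+\tfrac12\langle M(y-w),y-w\rangle\}$. Constants and Lyapunov function. For $\delta>0$: $a:=\frac{\delta}{\alpha}$, $b:=\frac{1}{2\alpha}-\frac{L}{4}-\frac{\delta}{\alpha}-\frac{\alpha\delta L^2}{2}-\delta L+\frac{\alpha L^2}{4\delta}$, $c:=b-\frac{\alpha L^2}{2\delta}$. Define $\mathscr{L}(x,y,u,v):=\mathcal{L}(x,y)-a\|x-u\|^2+b\|x-v\|^2$ for $x,u,v\in\mathbb{X}$, $y\in\mathbb{Y}^*$, and $\partial\mathscr{L}(x,y,u,v):=\{\nabla f(x)+A^Ty-2a(x-u)+2b(x-v)\}\times(Ax-\partial h^*(y))\times\{2a(x-u)\}\times\{2b(v-x)\}$.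 KL functions. A function $\Phi$ with subdifferential $\partial\Phi$ (for $\Phi=\mathscr{L}$ the one just defined) has the KL property at $\bar z\in\mathrm{dom}\,\partial\Phi:=\{z:\partial\Phi(z)\ne\emptyset\}$ if there exist $\eta\in(0,+\infty]$, a neighborhood $U$ of $\bar z$ and a continuous concave $\varphi:[0,\eta)\to[0,+\infty)$ with $\varphi(0)=0$, $\varphi$ continuously differentiable with $\varphi'>0$ on $(0,\eta)$, such that $\varphi'(\Phi(z)-\Phi(\bar z))\cdot\mathrm{dist}(0,\partial\Phi(z))\ge1$ for all $z\in U$ with $0<\Phi(z)-\Phi(\bar z)<\eta$. $\Phi$ is a KL function if it has the KL property at every point of $\mathrm{dom}\,\partial\Phi$. *)

(* Defs.v *)
From HB Require Import structures.
From mathcomp Require Import all_boot all_order all_algebra.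
From mathcomp Require Import sesquilinear.
From mathcomp Require Import all_classical all_reals all_analysis.

Set Implicit Arguments.
Unset Strict Implicit.
Unset Printing Implicit Defensive.

Import Order.TTheory GRing.Theory Num.Theory.
Import numFieldNormedType.Exports.

Local Open Scope classical_set_scope.
Local Open Scope ring_scope.

HB.structure Definition NormedVector (R : realType) :=
  {V of NormedModule R V & Vector R V}.

(* Finite-dimensional real inner product spaces: [normedModType] is what the
   library's topology and Frechet derivative need, [vectType] gives finite
   dimension, and the norm is required to be the one of the inner product. *)
HB.mixin Record NormedVector_isEuclidean (R : realType) V
    of NormedVector R V := {
  inner : {dot V for @idfun R} ;
  sqr_norm_inner : forall x : V, `|x| ^+ 2 = inner x x
}.

#[short(type="euclideanType")]
HB.structure Definition Euclidean (R : realType) :=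
  {V of NormedVector R V & NormedVector_isEuclidean R V}.

Notation "''[' x , y ]" := (inner x y) : ring_scope.

(* The dual of a Euclidean space is identified with the space itself. *)

Section Calculus.
Context {R : realType}.

Definition is_adjoint (X Y : euclideanType R) (A : 'Hom(X, Y))
    (AT : 'Hom(Y, X)) : Prop :=
  forall x y, '[A x, y] = '[x, AT y].

Definition is_gradient (X : euclideanType R) (f : X -> R) (gf : X -> X) : Prop :=
  forall x, differentiable (f : X -> R^o) x /\
    forall v, 'd (f : X -> R^o) x v = '[gf x, v].

End Calculus.

Section ConvexAnalysis.
Context {R : realType} {Y : euclideanType R}.
Implicit Types (g h : Y -> \bar R) (w y : Y).

Definition conjugate h y : \bar R :=
  ereal_sup [set ('[y, u]%:E - h u)%E | u in [set: Y]].

(* Convex subdifferential, empty at the points where [g] is not finite. *)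
Definition subdiff g y : set Y :=
  [set v | g y \is a fin_num /\
           forall z, (g y + '[v, z - y]%:E <= g z)%E].

Definition epigraph h : set (Y * R^o) := [set p | (h p.1 <= p.2%:E)%E].

(* [smallest] is the intersection of all the convex sets containing the
   epigraph, i.e. its convex hull. *)
Definition conv_fun h y : \bar R :=
  ereal_inf [set (p.2 : R)%:E
    | p in smallest (@convex_set R (Y * R^o)%type) (epigraph h) `&`
           [set p | p.1 = y]].

Definition proper_fun g : Prop :=
  (forall y, -oo < g y)%E /\ exists y, (g y < +oo)%E.

(* The set of minimizers, empty when [g] is identically [+oo]. *)
Definition argmin g : set Y :=
  [set y | (g y < +oo)%E /\ forall z, (g y <= g z)%E].

Definition prox (M : 'End(Y)) g w : set Y :=
  argmin (fun y => g y + (2^-1 * '[M (y - w), y - w])%:E)%E.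

End ConvexAnalysis.

Section KL.
Context {R : realType}.

(* Distance from 0 to [S] for the norm [N]; it is [+oo] when [S] is empty. *)
Definition dist0 (Z : Type) (N : Z -> R) (S : set Z) : \bar R :=
  ereal_inf [set (N z)%:E | z in S].

(* [0 <= t < eta] with [eta] possibly infinite. *)
Definition co_itv (eta : \bar R) : set R := [set t | 0 <= t /\ (t%:E < eta)%E].

Definition desingularizing (eta : \bar R) (phi : R -> R) : Prop :=
  [/\ forall t, t \in co_itv eta -> 0 <= phi t,
      phi 0 = 0,
      {within co_itv eta, continuous phi},
      convex_function (co_itv eta : set (convex_lmodType R^o))
                      (fun t => - phi t)
    & forall t : R, 0 < t -> (t%:E < eta)%E ->
        [/\ derivable phi t 1, {for t, continuous (derive1 phi)}
          & 0 < derive1 phi t] ].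

Definition KL_at (Z : topologicalType) (N : Z -> R) (Phi : Z -> \bar R)
    (dPhi : Z -> set Z) (zb : Z) : Prop :=
  exists (eta : \bar R) (U : set Z) (phi : R -> R),
    [/\ (0 < eta)%E, nbhs zb U, desingularizing eta phi &
      forall z, U z -> (0 < Phi z - Phi zb)%E -> (Phi z - Phi zb < eta)%E ->
        (1 <= (derive1 phi (fine (Phi z - Phi zb)))%:E * dist0 N (dPhi z))%E].

Definition KL_function (Z : topologicalType) (N : Z -> R) (Phi : Z -> \bar R)
    (dPhi : Z -> set Z) : Prop :=
  forall zb, dPhi zb !=set0 -> KL_at N Phi dPhi zb.

End KL.

Section Lagrangian.
Context {R : realType} {X Y : euclideanType R}.
Variables (f : X -> R) (gf : X -> X) (h : Y -> \bar R).
Variables (A : 'Hom(X, Y)) (AT : 'Hom(Y, X)).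
Implicit Types (x u v : X) (y : Y).

(* Equal to [-oo], for every [x], where [conjugate h y = +oo]; a lower bound in
   [x] can only be required for [y] in the domain of the conjugate. *)
Definition Lag x y : \bar R := ((f x + '[y, A x])%:E - conjugate h y)%E.

Definition dLag x y : set (X * Y) :=
  [set gf x + AT y] `*` [set A x - s | s in subdiff (conjugate h) y].

Definition crit_Lag : set (X * Y) := [set p | dLag p.1 p.2 (0, 0)].

Local Notation Z := (X * Y * X * X)%type.

(* Norm of the product inner product; the library's norm on products is the
   maximum of the norms of the components. *)
Definition norm4 (z : Z) : R :=
  let: (x, y, u, v) := z in
  Num.sqrt (`|x| ^+ 2 + `|y| ^+ 2 + `|u| ^+ 2 + `|v| ^+ 2).

Definition Lyap (a b : R) (z : Z) : \bar R :=
  let: (x, y, u, v) := z in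
  (Lag x y - (a * `|x - u| ^+ 2)%:E + (b * `|x - v| ^+ 2)%:E)%E.

Definition dLyap (a b : R) (z : Z) : set Z :=
  let: (x, y, u, v) := z in
  [set gf x + AT y - (2 * a) *: (x - u) + (2 * b) *: (x - v)]
  `*` [set A x - s | s in subdiff (conjugate h) y]
  `*` [set (2 * a) *: (x - u)]
  `*` [set (2 * b) *: (v - x)].

Definition precond (alpha : R) : 'End(Y) := alpha *: (A \o AT)%VF.

(* [(_)^-1%VF] is a two-sided inverse here, [precond] being injective when [A]
   is surjective and [alpha != 0]. *)
Definition PPDG (alpha : R) (x : nat -> X) (y : nat -> Y) : Prop :=
  forall k,
    x k.+1 = x k - alpha *: (gf (x k) + AT (y k)) /\
    prox (precond alpha) (conjugate h)
      (y k + ((precond alpha)^-1)%VF (A (2 *: x k.+1 - x k))) (y k.+1).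

End Lagrangian.

Section Constants.
Context {R : realType}.
Variables (alpha L delta : R).

Definition cst_a : R := delta / alpha.

Definition cst_b : R :=
  1 / (2 * alpha) - L / 4 - delta / alpha - alpha * delta * L ^+ 2 / 2
  - delta * L + alpha * L ^+ 2 / (4 * delta).

Definition cst_c : R := cst_b - alpha * L ^+ 2 / (2 * delta).

End Constants.

(* Main.v *)
(* With d_k = x_{k+1} - x_k, the optimality condition of the proximal step reads
   A (x_{k+1} + alpha (grad f(x_k) - grad f(x_{k-1}))) \in subdiff h^* (y_k), and
   alpha A^T (y_{k+1} - y_k) = d_k - d_{k+1} - alpha (grad f(x_{k+1}) - grad f(x_k)).
   The descent lemma in x, the subgradient inequality for h^* in y and Young's
   inequality show that the Lyapunov function at
   z_k = (x_k, y_k, x_{k+1}, x_{k-1}) decreases by at least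
   c (|d_k|^2 + |d_{k-1}|^2), while its subdifferential at z_k contains an element
   of norm O(|d_k| + |d_{k-1}|).  Both bounds involve the same two steps, so the KL
   inequality at a cluster point makes phi (Lyap z_k - lim) decrease by a multiple
   of |d_k| + |d_{k-1}|: the length is finite, and the iterates are trapped near the
   cluster point.  The values h^* (y_k) converge along the subsequence because h^*
   is lower semicontinuous and the subgradients stay bounded. *)

Require Import Defs.
From HB Require Import structures.
From mathcomp Require Import all_boot all_order all_algebra.
From mathcomp Require Import sesquilinear.
From mathcomp Require Import all_classical all_reals all_analysis.
From mathcomp Require Import ring lra.

Set Implicit Arguments.
Unset Strict Implicit.
Unset Printing Implicit Defensive.

Import Order.TTheory GRing.Theory Num.Theory.
Import numFieldNormedType.Exports VectorInternalTheory.

Local Open Scope classical_set_scope.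
Local Open Scope ring_scope.

(** * Euclidean spaces *)

Section Euclidean.
Context {R : realType}.
Implicit Types V X Y : euclideanType R.

Lemma innerC V (u v : V) : '[u, v] = '[v, u].
Proof. by rewrite hermC /= expr0 mul1r. Qed.

Lemma innerDl V (u v w : V) : '[u + v, w] = '[u, w] + '[v, w].
Proof. exact: linearDl. Qed.

Lemma innerDr V (u v w : V) : '[w, u + v] = '[w, u] + '[w, v].
Proof. exact: linearDr. Qed.

Lemma innerNl V (u v : V) : '[- u, v] = - '[u, v].
Proof. exact: linearNl. Qed.

Lemma innerNr V (u v : V) : '[u, - v] = - '[u, v].
Proof. exact: linearNr. Qed.

Lemma innerZl V a (u v : V) : '[a *: u, v] = a * '[u, v].
Proof. exact: linearZl_LR. Qed.

Lemma innerZr V a (u v : V) : '[u, a *: v] = a * '[u, v].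
Proof. exact: linearZr_LR. Qed.

Lemma inner0l V (u : V) : '[0, u] = 0.
Proof. exact: linear0l. Qed.

Lemma inner0r V (u : V) : '[u, 0] = 0.
Proof. exact: linear0r. Qed.

Definition innerE := (innerDl, innerDr, innerNl, innerNr, innerZl, innerZr).

Lemma sqr_normD V (u v : V) :
  `|u + v| ^+ 2 = `|u| ^+ 2 + 2 * '[u, v] + `|v| ^+ 2.
Proof. by rewrite !sqr_norm_inner !innerE (innerC v u); ring. Qed.

Lemma sqr_normB V (u v : V) :
  `|u - v| ^+ 2 = `|u| ^+ 2 - 2 * '[u, v] + `|v| ^+ 2.
Proof. by rewrite sqr_normD normrN innerNr; ring. Qed.

(** Young's inequality with a free weight: expand the square of the norm of [t *: u - v] and divide
    by [2 * t]. *)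
Lemma inner_le_sqr V (t : R) (u v : V) : 0 < t ->
  '[u, v] <= t / 2 * `|u| ^+ 2 + (2 * t)^-1 * `|v| ^+ 2.
Proof.
move=> t0; have := sqr_ge0 `|t *: u - v|.
rewrite sqr_normB normrZ innerZl gtr0_norm // exprMn => h.
rewrite -(ler_pM2l (_ : 0 < 2 * t)); last by rewrite mulr_gt0.
rewrite mulrDr [X in _ <= _ + X]mulrA divff ?mul1r; last by rewrite mulf_neq0 ?gt_eqF.
lra.
Qed.

(** Cauchy-Schwarz is the weighted inequality at the optimal weight [|v| / |u|], where both terms
    are equal. *)
Lemma inner_norm_le V (u v : V) : '[u, v] <= `|u| * `|v|.
Proof.
have [->|u0] := eqVneq u 0; first by rewrite inner0l normr0 mul0r.
have [->|v0] := eqVneq v 0; first by rewrite inner0r normr0 mulr0.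
have pu : 0 < `|u| by rewrite normr_gt0.
have pv : 0 < `|v| by rewrite normr_gt0.
apply: le_trans (inner_le_sqr u v (divr_gt0 pv pu)) _.
rewrite le_eqVlt; apply/orP; left; apply/eqP; field.
by rewrite !gt_eqF.
Qed.

Lemma abs_inner_le V (u v : V) : `|'[u, v]| <= `|u| * `|v|.
Proof.
rewrite ler_norml inner_norm_le andbT lerNl -innerNl.
by rewrite -(normrN u) inner_norm_le.
Qed.

Lemma norm_rV_le n (v : 'rV[R]_n) i : `|v 0 i| <= `|v|.
Proof.
rewrite [leRHS]/Num.norm /= mx_normrE.
by apply/bigmax_geP; right; exists (0, i).
Qed.

Lemma linear_rV_bounded n (W : normedModType R) (g : {linear 'rV[R]_n -> W}) :
  exists2 C, 0 <= C & forall v, `|g v| <= C * `|v|.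
Proof.
exists (\sum_(i < n) `|g 'e_i|); first by apply: sumr_ge0.
move=> v; rewrite {1}[v]row_sum_delta linear_sum /=.
apply: le_trans (ler_norm_sum _ _ _) _.
rewrite mulr_suml; apply: ler_sum => i _.
by rewrite linearZ /= normrZ mulrC ler_wpM2l // norm_rV_le.
Qed.

Lemma linear_rV_continuous n (W : normedModType R)
  (g : {linear 'rV[R]_n -> W}) : continuous g.
Proof.
have [C C0 gC] := linear_rV_bounded g.
apply: bounded_linear_continuous; apply/linear_boundedP.
exists C; split; first exact: num_real.
move=> r Cr u; apply: le_trans (gC u) _.
by rewrite ler_wpM2r // ltW.
Qed.

Lemma r2v_continuous V : continuous (r2v : 'rV[R]_(dim V) -> V).
Proof. exact: linear_rV_continuous. Qed.

(** Comparison of norms by compactness: [r2v] is injective, so the norm of [r2v w] has a positive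
    minimum on the unit sphere of row vectors, and its inverse is the constant. *)
Lemma v2r_bounded V : exists2 C : R, 0 < C &
  forall u : V, `|v2r u| <= C * `|u|.
Proof.
pose S := [set v : 'rV[R]_(dim V) | `|v| = 1].
have Scompact : compact S.
  apply: bounded_closed_compact.
    by exists 1; split; [exact: num_real|move=> M M1 v /= ->; exact: ltW].
  rewrite (_ : S = Num.norm @^-1` [set 1]); last by [].
  apply: closed_comp; last exact: closed_eq.
  by move=> v _; exact: norm_continuous.
have unitS (w : 'rV[R]_(dim V)) : w != 0 -> `|w|^-1 *: w \in S.
  move=> w0; rewrite inE /S /= normrZ normfV normr_id mulVf //.
  by rewrite normr_eq0.
(* The minimum needs a nonempty sphere; an empty one means that every coordinate vector is zero. *)
have [S0|/set0P[v1 Sv1]] := eqVneq S set0.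
  exists 1 => // u; rewrite mul1r; have [->|w0] := eqVneq (v2r u) 0.
    by rewrite normr0.
  by exfalso; have := unitS _ w0; rewrite S0 inE.
have [|c cS cmin] := @compact_EVT_min _ R (fun w : 'rV[R]_(dim V) => `|r2v w : V|)
  S (ex_intro _ v1 Sv1) Scompact.
  apply: continuous_subspaceT => w; apply: continuous_comp.
    by have := @r2v_continuous V w.
  exact: norm_continuous.
have c0 : 0 < `|r2v c : V|.
  rewrite normr_gt0; apply/negP => /eqP rc0.
  have c0 : c = 0 by rewrite -[c]r2vK rc0 linear0.
  move: cS; rewrite inE /S /= c0 normr0 => /esym/eqP; by rewrite oner_eq0.
exists (`|r2v c : V|^-1); first by rewrite invr_gt0.
move=> u; have [->|w0] := eqVneq (v2r u) 0.
  by rewrite normr0 mulr_ge0 // invr_ge0.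
have := cmin _ (unitS _ w0).
rewrite linearZ /= v2rK normrZ normfV normr_id.
by rewrite ler_pdivlMl ?normr_gt0 // ler_pdivlMl // mulrC.
Qed.

Lemma linear_bounded X Y (B : {linear X -> Y}) :
  exists2 C : R, 0 <= C & forall u, `|B u| <= C * `|u|.
Proof.
have [C C0 hC] := v2r_bounded X.
have [D D0 hD] := linear_rV_bounded (B \o r2v : {linear 'rV[R]_(dim X) -> Y}).
exists (D * C); first by rewrite mulr_ge0 // ltW.
move=> u; rewrite -[u in leLHS]v2rK; apply: le_trans (hD _) _.
by rewrite -mulrA ler_wpM2l.
Qed.

Lemma euclid_linear_continuous X Y (B : {linear X -> Y}) : continuous B.
Proof.
have [C C0 BC] := linear_bounded B.
apply: bounded_linear_continuous; apply/linear_boundedP.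
exists C; split; first exact: num_real.
move=> r Cr u; apply: le_trans (BC u) _.
by rewrite ler_wpM2r // ltW.
Qed.

(** Compactness is carried over from row vectors: [K] is the image under [r2v] of a closed
    coordinate ball. *)
Lemma euclid_ball_compact V (M : R) :
  exists2 K : set V, compact K & [set u | `|u| <= M] `<=` K.
Proof.
have [C C0 hC] := v2r_bounded V.
exists (r2v @` [set w : 'rV[R]_(dim V) | `|w| <= C * M]).
  apply: continuous_compact.
    by apply: continuous_subspaceT; exact: r2v_continuous.
  apply: bounded_closed_compact.
    exists (C * M); split; first exact: num_real.
    by move=> t Mt w /= /le_trans; apply; exact: ltW.
  exact: (closed_comp (fun v _ => @norm_continuous _ _ v)
    (@closed_le R (C * M))).
move=> u /= uM; exists (v2r u); last exact: v2rK.
by apply: le_trans (hC u) _; rewrite ler_pM2l.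
Qed.

End Euclidean.

(** * Smooth descent, conjugates and desingularizing functions *)

Section SmoothDescent.
Context {R : realType} {X : euclideanType R}.

Lemma is_derive_line (f : X -> R^o) (u d : X) (t : R) :
  differentiable f (u + t *: d) ->
  is_derive t (1 : R) (fun s : R => f (u + s *: d)) ('d f (u + t *: d) d).
Proof.
move=> df; have fd := @diff_derivable _ _ _ f _ d df.
have E : (fun h : R => h^-1 *:
    ((fun s : R => f (u + s *: d)) (h *: (1 : R) + t) - f (u + t *: d))) =
   (fun h : R => h^-1 *: (f (h *: d + (u + t *: d)) - f (u + t *: d))).
  apply: funext => h; congr (_ *: (f _ - _)).
  by rewrite scalerDl -[h *: 1]/(h * 1) mulr1 addrCA.
apply: DeriveDef; first by rewrite /derivable E.
by rewrite /derive E -deriveE.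
Qed.

Lemma descent_lemma (f : X -> R) (gf : X -> X) (L : R) :
  is_gradient f gf -> (forall u v, `|gf u - gf v| <= L * `|u - v|) ->
  forall u d, f (u + d) <= f u + '[gf u, d] + L / 2 * `|d| ^+ 2.
Proof.
move=> fg gL u d.
(* Along the segment, [g] is [f] minus its linear part at [u] and the quadratic bound. The Lipschitz
   gradient makes its derivative nonpositive on [0, 1], and [g 1 <= g 0] is the claim. *)
pose g (t : R) : R := f (u + t *: d) - '[gf u, d] * t - L / 2 * `|d| ^+ 2 * t ^+ 2.
have dg (t : R) : is_derive t (1 : R) g
    ('[gf (u + t *: d) - gf u, d] - L * t * `|d| ^+ 2).
  have [df dfE] := fg (u + t *: d).
  have h1 := is_derive_line df.
  rewrite innerDl innerNl -dfE.
  rewrite /g; apply: is_derive_eq.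
  by rewrite !scaler1 /= -[_ *: (t + t)]/(_ * (t + t)); field.
have : g 1 <= g 0.
  apply: (@ler0_derive1_le_cc R g 0 1) => //; rewrite ?in_itv /= ?lexx ?ler01 //.
  - move=> t; rewrite in_itv /= => /andP[t0 t1].
    rewrite derive1E derive_val subr_le0.
    apply: le_trans (inner_norm_le _ _) _; rewrite expr2 mulrA ler_wpM2r //.
    apply: le_trans (gL _ _) _.
    by rewrite addrAC subrr add0r normrZ gtr0_norm // mulrA.
  - apply: continuous_subspaceT => t.
    have /derivable1_diffP/differentiable_continuous :=
      @ex_derive _ _ _ _ _ _ _ (dg t).
    exact.
rewrite /g scale1r scale0r addr0; lra.
Qed.
End SmoothDescent.

(** This is the limit at [t = 0], used to extract a first-order condition from minimality along a
    segment. *)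
Lemma ge0_affine_near0 (R : realType) (a b : R) :
  (forall t, 0 < t -> t <= 1 -> 0 <= a + t * b) -> 0 <= a.
Proof.
move=> H; rewrite leNgt; apply/negP => a0.
(* If [a < 0], this [t] makes [t * b] at most [- a / 2], so the affine value stays negative. *)
pose t := Num.min 1 (- a / (2 * (`|b| + 1))).
have b1 : 0 < `|b| + 1 by rewrite ltr_wpDl.
have t0 : 0 < t by rewrite /t lt_min ltr01 divr_gt0 ?oppr_gt0 // mulr_gt0.
have := H t t0; rewrite /t ge_min lexx /= -/t => /(_ isT).
have : t * (2 * (`|b| + 1)) <= - a.
  by rewrite -ler_pdivlMr ?mulr_gt0 // /t ge_min lexx orbT.
have : t * b <= t * `|b| by rewrite ler_pM2l // ler_norm.
by nra.
Qed.

(** Polarization reduces the claim to continuity of the norm. *)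
Lemma cvg_inner {R : realType} {V : euclideanType R} {T} {F : set_system T}
  {FF : ProperFilter F} (u v : T -> V) a b :
  u @ F --> a -> v @ F --> b -> '[u x, v x] @[x --> F] --> '[a, b].
Proof.
move=> ua vb.
have polar (x y : V) : '[x, y] = (`|x + y| ^+ 2 - `|x - y| ^+ 2) / 4.
  by rewrite sqr_normD sqr_normB; field.
rewrite polar; under eq_fun do rewrite polar.
apply: cvgMr_tmp; apply: cvgB.
  rewrite expr2; under eq_fun do rewrite expr2.
  by apply: cvgM; apply: cvg_norm; apply: cvgD.
rewrite expr2; under eq_fun do rewrite expr2.
by apply: cvgM; apply: cvg_norm; apply: cvgB.
Qed.

(** * Conjugates, and the optimality condition of the proximal step *)

Section ConjugateTheory.
Context {R : realType} {Y : euclideanType R}.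
Variable h : Y -> \bar R.
Hypothesis h_gtNy : forall u, (-oo < h u)%E.

(** Points where [h] is [+oo] contribute [-oo] to the supremum. What remains is a family of real
    affine inequalities in [y], from which convexity and lower semicontinuity both follow. *)
Lemma conjugate_leP y (b : R) : (conjugate h y <= b%:E)%E <->
  forall u r, h u = r%:E -> '[y, u] - r <= b.
Proof.
split=> [hb u r hu|H].
  rewrite -lee_fin; apply: le_trans hb; apply: ereal_sup_ubound.
  by exists u => //; rewrite hu.
apply: ge_ereal_sup => _ [u _ <-].
case E: (h u) => [r| |]; last by have := h_gtNy u; rewrite E.
  by rewrite -EFinB lee_fin; apply: H.
by rewrite leNye.
Qed.

Hypothesis h_dom : exists u r, h u = r%:E.

Lemma conjugate_gtNy y : (-oo < conjugate h y)%E.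
Proof.
have [u [r hu]] := h_dom.
apply: (@lt_le_trans _ _ ('[y, u] - r)%:E); first by rewrite ltNyr.
by apply: ereal_sup_ubound; exists u => //; rewrite hu.
Qed.

Lemma conjugate_convex y z (p q t : R) : 0 <= t -> t <= 1 ->
  conjugate h y = p%:E -> conjugate h z = q%:E ->
  (conjugate h (y + t *: (z - y))%R <= ((1 - t) * p + t * q)%:E)%E.
Proof.
move=> t0 t1 hy hz; apply/conjugate_leP => u r hu.
have hyp : '[y, u] - r <= p.
  by have /conjugate_leP/(_ u r hu) : (conjugate h y <= p%:E)%E by rewrite hy.
have hzq : '[z, u] - r <= q.
  by have /conjugate_leP/(_ u r hu) : (conjugate h z <= q%:E)%E by rewrite hz.
rewrite !innerE; nra.
Qed.

(** Lower semicontinuity along sequences: each affine minorant passes to the limit separately. *)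
Lemma conjugate_cvg_le (y : nat -> Y) (b : nat -> R) (y0 : Y) (b0 : R) :
  y @ \oo --> y0 -> b @ \oo --> b0 ->
  (forall k, (conjugate h (y k) <= (b k)%:E)%E) -> (conjugate h y0 <= b0%:E)%E.
Proof.
move=> yy0 bb0 hyb; apply/conjugate_leP => u r hu.
apply: (@ler_cvg_to _ _ _ R (fun k => '[y k, u] - r) b _ _ _ bb0).
  apply: cvgB; last exact: cvg_cst.
  exact: (cvg_inner yy0 (cvg_cst _)).
near=> k; have /conjugate_leP := hyb k; exact.
Unshelve. all: by end_near.
Qed.

(** The minimizer [y] is compared with [y + t *: (z - y)]: convexity bounds the conjugate there, and
    dividing by [t] leaves the subgradient inequality up to a term linear in [t]. *)
Lemma prox_subdiff (B : 'End(Y)) w y :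
  (forall u v, '[B u, v] = '[u, B v]) ->
  prox B (conjugate h) w y -> subdiff (conjugate h) y (B (w - y)).
Proof.
move=> Bsym [gy ymin].
have [p hp] : exists p, conjugate h y = p%:E.
  have := conjugate_gtNy y; move: gy; case: (conjugate h y) => [p| |] //.
  by move=> _ _; exists p.
split; first by rewrite hp.
move=> z; rewrite hp.
have := conjugate_gtNy z; case hq : (conjugate h z) => [q| |] // _; last by rewrite leey.
rewrite -EFinD lee_fin -subr_ge0.
apply: (@ge0_affine_near0 _ _ (2^-1 * '[B (z - y), z - y])) => t t0 t1.
have := ymin (y + t *: (z - y)).
have := conjugate_convex (ltW t0) t1 hp hq.
have := conjugate_gtNy (y + t *: (z - y)).
case: (conjugate h (y + t *: (z - y))) => [r| |] // _.
rewrite hp -!EFinD !lee_fin => rle.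
rewrite (_ : y + t *: (z - y) - w = (y - w) + t *: (z - y)); last by rewrite addrAC.
rewrite -(opprB y w) !(linearD, linearN, linearZ) /= !innerE.
rewrite (Bsym z y) (Bsym z w) (Bsym y w).
rewrite (innerC z (B y)) (innerC z (B w)) (innerC y (B w)) => H.
rewrite -(pmulr_rge0 _ t0); nra.
Qed.

End ConjugateTheory.

Lemma proper_conv_fun_dom (R : realType) (Y : euclideanType R) (h : Y -> \bar R) :
  (forall u, (-oo < h u)%E) ->
  proper_fun (conv_fun h) -> exists u r, h u = r%:E.
Proof.
move=> hN [_ [y /ereal_inf_lt[_ [p [sp _] _] _]]].
(* If [h] were finite nowhere, its epigraph would be empty, so [set0] would be a convex set
   containing it and the hull could not contain [p]. *)
apply/not_existsP => noh; apply: (sp set0); split.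
  by move=> a b l; rewrite inE.
move=> q; rewrite /epigraph /= => hq; apply: (noh q.1).
case E: (h q.1) => [r| |]; first by exists r.
  by move: hq; rewrite E leNgt ltry.
by have := hN q.1; rewrite E.
Qed.

(** The tangent inequality of a concave function. Only the derivative at [s] enters, since [t] may
    be 0, where [phi] is merely continuous. *)
Lemma desingularizing_concave_le (R : realType) (eta : \bar R) (phi : R -> R) s t :
  desingularizing eta phi -> 0 <= t -> t <= s -> 0 < s -> (s%:E < eta)%E ->
  derive1 phi s * (s - t) <= phi s - phi t.
Proof.
move=> [_ _ _ cvx dphi] t0 ts s0 se.
have [dphis _ _] := dphi s s0 se.
have [->|st] := eqVneq s t; first by rewrite !subrr mulr0.
have {st}ts : t < s by rewrite lt_neqAle eq_sym st.
have st0 : 0 < s - t by rewrite subr_gt0.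
rewrite -ler_pdivlMr // leNgt; apply/negP => lts.
(* By concavity, the difference quotients to the left of [s] are at most the slope of the chord from
   [t] to [s]. *)
have chord (l : R) : 0 < l -> l <= 1 ->
    l * (phi s - phi t) >= phi s - phi (s - l * (s - t)).
  move=> l0 l1.
  have := cvx (Itv01 (ltW l0) l1) t s.
  have inco r : 0 <= r -> r <= s -> r \in (co_itv eta : set (convex_lmodType R^o)).
    move=> r0 rs; rewrite inE; split => //.
    by apply: le_lt_trans se; rewrite lee_fin.
  move=> /(_ (inco _ t0 (ltW ts)) (inco _ (ltW s0) (lexx s))).
  rewrite /conv /= /unstable.onem.
  rewrite (_ : l *: t + (1 - l) *: s = s - l * (s - t)); last first.
    by rewrite -![_ *: _]/(_ * _); ring.
  move=> H; have {}H : - phi (s - l * (s - t)) <= l * - phi t + (1 - l) * - phi s := H.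
  lra.
have [e e0 he] : \forall h \near nbhs (0 : R)^',
    (phi s - phi t) / (s - t) < h^-1 *: (phi (h *: (1 : R) + s) - phi s).
  by apply: (@cvgr_gt R R _ _ _ _ dphis); rewrite derive1E in lts.
(* The quotient at [- k] must exceed the chord slope because [k < e], and cannot because
   [k <= s - t] allows [chord] with [l = k / (s - t)]. *)
pose k := Num.min (e / 2) (s - t).
have k0 : 0 < k by rewrite lt_min st0 divr_gt0.
have kst : k <= s - t by rewrite ge_min lexx orbT.
have := he (- k); rewrite /= sub0r opprK gtr0_norm // => /(_ _ _).
have ke : k < e by rewrite gt_min ltr_pdivrMr // ltr_pMr // ltr1n.
move=> /(_ ke); rewrite oppr_eq0 gt_eqF // => /(_ isT).
rewrite -![_ *: _]/(_ * _) mulr1 invrN mulNr -mulrN opprB ltNge => /negP; apply.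
have := @chord (k / (s - t)); rewrite divr_gt0 // ler_pdivrMr // mul1r kst.
move=> /(_ isT isT); rewrite mulfVK ?gt_eqF // [- k + s]addrC.
by rewrite ler_pdivrMl // mulrA mulrAC.
Qed.

(** * Sequences *)

(** Pairing with an arbitrary [w] turns linear identities between vectors into identities of reals
    that [ring] and [field] can decide. *)
Lemma inner_inj (R : realType) (V : euclideanType R) (u v : V) :
  (forall w, '[u, w] = '[v, w]) -> u = v.
Proof.
move=> uv; apply/eqP; rewrite -subr_eq0 -normr_eq0 -sqrf_eq0 sqr_norm_inner.
by rewrite innerDl innerNl uv subrr.
Qed.

Lemma cvgn_lt0 (R : realType) (u : nat -> R) (eps : R) :
  u @ \oo --> 0 -> 0 < eps -> exists N, forall k, (N <= k)%N -> u k < eps.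
Proof.
move=> u0 e0; have [N _ hN] : \forall k \near \oo, u k < eps.
  exact: (cvgr_lt _ u0).
by exists N.
Qed.

Lemma cvg_norm_le0 (R : realType) (V : normedModType R) (u : nat -> V) (v : nat -> R) :
  (forall k, `|u k| <= v k) -> v @ \oo --> 0 -> u @ \oo --> 0.
Proof.
move=> uv v0; apply/cvgrPdist_lt => e e0; have [N hN] := cvgn_lt0 v0 e0.
exists N => // k /= /hN; rewrite sub0r normrN; exact: le_lt_trans.
Qed.

Lemma lfun_cvg (R : realType) (X Y : euclideanType R) (B : 'Hom(X, Y))
  (u : nat -> X) (l : X) : u @ \oo --> l -> (fun k => B (u k)) @ \oo --> B l.
Proof. by move=> ul; apply: (cvg_comp _ _ ul); exact: euclid_linear_continuous. Qed.

Lemma cvg_subseq (T : topologicalType) (u : nat -> T) (p : T) (sigma : nat -> nat) :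
  (forall j, (j <= sigma j)%N) -> u @ \oo --> p -> (u \o sigma) @ \oo --> p.
Proof.
move=> sj up; apply: (cvg_comp _ _ _ up) => P [N _ hN]; exists N => // k /= Nk.
by apply: hN => /=; exact: leq_trans Nk (sj k).
Qed.

(** Bolzano-Weierstrass: [sigma j] is an index at least [j] whose term lies within [1 / (j + 1)] of
    a cluster point. *)
Lemma bounded_cvg_subseq (R : realType) (V : euclideanType R) (u : nat -> V) (M : R) :
  (forall k, `|u k| <= M) ->
  exists (sigma : nat -> nat) (p : V),
    (forall j, (j <= sigma j)%N) /\ (u \o sigma) @ \oo --> p.
Proof.
move=> uM; have [K cK KM] := euclid_ball_compact V M.
have [|p [_ clp]] := cK (u @ \oo) _.
  by exists 0%N => // k _; exact/KM/uM.
have pick j : exists k, (j <= k)%N /\ `|p - u k| < j.+1%:R^-1.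
  have /= := clp [set u k | k in [set k | (j <= k)%N]] (ball p (j.+1%:R^-1)).
  case.
  - by exists j => // k jk; exists k.
  - by apply: nbhsx_ballx; rewrite invr_gt0.
  by move=> _ [[k jk <-]]; rewrite -ball_normE /= => pk; exists k.
have [sigma hs] := choice pick.
exists sigma, p; split; first by move=> j; have [] := hs j.
apply/cvgrPdist_lt => e e0.
have [N hN] := cvgn_lt0 (@cvg_harmonic R) e0.
exists N => // k /= Nk; apply: lt_trans (hN k Nk).
by have [] := hs k.
Qed.

Lemma bounded_partial_sums_nneseries (R : realType) (u : nat -> R) (B : R) m :
  (forall k, 0 <= u k) -> (forall n, \sum_(0 <= k < n) u k <= B) ->
  (\sum_(m <= k <oo) (u k)%:E < +oo)%E.
Proof.
move=> u0 uB; apply: (@le_lt_trans _ _ B%:E); last exact: ltry.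
apply: lime_le; first by apply: is_cvg_nneseries => k _ _; rewrite lee_fin.
near=> n; rewrite sumEFin lee_fin; apply: le_trans (uB n).
have mn : (m <= n)%N by near: n; exists m.
by rewrite (@big_cat_nat _ _ _ m 0 n) //= lerDr sumr_ge0.
Unshelve. all: by end_near.
Qed.

(* Once the distance [D] to a cluster point is small, the descent of [Psi]
   pays for all the later steps, so that [D] never becomes large again. *)
Lemma descent_trap (R : realType) (e D Psi : nat -> R) (K c r : R) (N0 : nat) :
  0 < K -> 0 < c -> 0 < r ->
  (forall k, 0 <= e k) -> (forall k, 0 <= D k) ->
  (forall k, (N0 <= k)%N -> 0 <= Psi k) ->
  e @ \oo --> 0 -> Psi @ \oo --> 0 ->
  (forall k, D k.+1 <= D k + K * (e k + e k.+1)) ->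
  (forall k, (N0 <= k)%N -> D k + e k < r -> c * e k <= Psi k - Psi k.+1) ->
  (forall eps N, 0 < eps -> exists2 k, (N <= k)%N & D k < eps) ->
  D @ \oo --> 0 /\ exists B, forall n, \sum_(0 <= k < n) e k <= B.
Proof.
move=> K0 c0 r0 e0 D0 Psi0 ecv Pcv Dstep desc clus.
have trap eps : 0 < eps -> eps <= r -> exists N, forall n,
    D (N + n)%N < eps /\ c * (\sum_(0 <= j < n) e (N + j)%N) <= Psi N.
  move=> eps0 epsr.
  (* The start [N] is chosen so that [D N], [(K + 1) * e] from [N] on, and [2 * K * Psi N / c] are
     each below [eps / 4]; their sum bounds [D + e] by less than [eps]. *)
  have [N1 hN1] := @cvgn_lt0 R e (eps / (4 * (K + 1))) ecv
    (divr_gt0 eps0 (mulr_gt0 (ltr0n _ 4) (addr_gt0 K0 ltr01))).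
  have [N2 hN2] := @cvgn_lt0 R Psi (eps * c / (8 * K)) Pcv
    (divr_gt0 (mulr_gt0 eps0 c0) (mulr_gt0 (ltr0n _ 8) K0)).
  have [N] := clus (eps / 4) (maxn N0 (maxn N1 N2)) (divr_gt0 eps0 (ltr0n _ 4)).
  rewrite !geq_max => /and3P[N0N N1N N2N] DN; exists N.
  have N0n n : (N0 <= N + n)%N := leq_trans N0N (leq_addr n N).
  have eN k : (K + 1) * e (N + k)%N < eps / 4.
    have := hN1 (N + k)%N (leq_trans N1N (leq_addr _ _)).
    rewrite ltr_pdivlMr ?mulr_gt0 ?addr_gt0 // => h.
    by rewrite ltr_pdivlMr // mulrAC mulrC mulrA mulrAC -mulrA.
  have PN : 8 * K * Psi N < eps * c.
    have := hN2 N N2N; rewrite ltr_pdivlMr ?mulr_gt0 //.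
    by rewrite mulrC.
  pose S n := \sum_(0 <= j < n) e (N + j)%N.
  have S0 n : 0 <= S n by apply: sumr_ge0.
  have small n : c * S n <= Psi N -> D (N + n)%N <= D N + K * (2 * S n + e (N + n)%N) ->
      D (N + n)%N + e (N + n)%N < eps.
    move=> cS Dn.
    have : K * (2 * S n) < eps / 4.
      rewrite -(ltr_pM2l c0); have := ler_wpM2l (ltW K0) cS; lra.
    have := eN n; lra.
  (* Both telescoping bounds are proved together: the second keeps the sequence in the region where
     descent holds, which extends the first. Each [e] is counted by two successive steps of [D],
     whence [2 * S n] and one unpaired last term. *)
  have inv n : c * S n <= Psi N - Psi (N + n)%N /\
      D (N + n)%N <= D N + K * (2 * S n + e (N + n)%N).
    elim: n => [|n [IH1 IH2]].
      rewrite /S big_geq // addn0 mulr0 subrr mulr0 add0r; split => //.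
      by rewrite lerDl mulr_ge0 // ltW.
    have cS : c * S n <= Psi N by have := Psi0 _ (N0n n); lra.
    have := desc _ (N0n n) (lt_le_trans (small n cS IH2) epsr).
    rewrite -addnS => h1.
    have SS : S n.+1 = S n + e (N + n)%N by rewrite /S big_nat_recr.
    rewrite SS; split; first by lra.
    have := Dstep (N + n)%N; rewrite -addnS; lra.
  move=> n; have [i1 i2] := inv n.
  have cS : c * S n <= Psi N by have := Psi0 _ (N0n n); lra.
  split => //; have := small n cS i2; have := e0 (N + n)%N; lra.
split.
  apply/cvgrPdist_lt => eps eps0.
  have [||N hN] := trap (Num.min eps r).
  - by rewrite lt_min eps0.
  - by rewrite ge_min lexx orbT.
  exists N => // k /= Nk; rewrite sub0r normrN ger0_norm //.
  have [+ _] := hN (k - N)%N; rewrite subnKC // => /lt_le_trans; apply.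
  by rewrite ge_min lexx.
have [N hN] := trap r r0 (lexx r).
exists (\sum_(0 <= k < N) e k + Psi N / c) => n.
apply: (@le_trans _ _ (\sum_(0 <= k < N + n) e k)).
  by rewrite addnC (@big_cat_nat _ _ _ n 0 (n + N)) ?leq_addr //= lerDl sumr_ge0.
rewrite (@big_cat_nat _ _ _ N 0 (N + n)) ?leq_addr //= lerD2l.
have [_ +] := hN n; rewrite mulrC -ler_pdivlMr //; apply: le_trans.
rewrite -{1}[N]add0n big_addn addnC addnK.
by under eq_bigr do rewrite addnC.
Qed.

(** * The PPDG iteration *)

Section PPDG.
Context {R : realType} {X Y : euclideanType R}.
Variables (f : X -> R) (gf : X -> X) (h : Y -> \bar R).
Variables (A : 'Hom(X, Y)) (AT : 'Hom(Y, X)).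
Variables (L alpha delta : R) (x : nat -> X) (y : nat -> Y).
Hypothesis f_grad : is_gradient f gf.
Hypothesis h_gtNy : forall u, (-oo < h u)%E.
Hypothesis h_dom : exists u r, h u = r%:E.
Hypothesis A_adj : is_adjoint A AT.
Hypothesis L_gt0 : 0 < L.
Hypothesis gf_lip : forall u v, `|gf u - gf v| <= L * `|u - v|.
Hypothesis A_surj : forall w, exists u, A u = w.
Hypothesis alpha_gt0 : 0 < alpha.
Hypothesis delta_gt0 : 0 < delta.
Hypothesis xy_PPDG : PPDG gf h A AT alpha x y.

Local Notation M := (precond A AT alpha).
Local Notation a := (cst_a alpha delta).
Local Notation b := (cst_b alpha L delta).
Local Notation c := (cst_c alpha L delta).

(** * Injectivity of the adjoint and inversion of the preconditioner *)

Lemma adjoint_inj (v : Y) : AT v = 0 -> v = 0.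
Proof.
move=> v0; apply: inner_inj => w; have [u <-] := A_surj w.
by rewrite innerC A_adj v0 inner0r inner0l.
Qed.

(** An injective linear map has a linear left inverse, which is bounded in finite dimension. The
    constant is [C + 1] because [C] may be zero. *)
Lemma adjoint_bounded_below :
  exists2 C : R, 0 < C & forall v, `|v| <= C * `|AT v|.
Proof.
have kAT : lker AT == 0%VS.
  apply/lker0P => u v uv; apply/eqP; rewrite -subr_eq0; apply/eqP.
  by apply: adjoint_inj; rewrite linearB /= uv subrr.
have [C C0 hC] := linear_bounded (AT^-1)%VF.
exists (C + 1); first by rewrite ltr_wpDl.
move=> v; rewrite -[v in leLHS](lker0_lfunK kAT); apply: le_trans (hC _) _.
by rewrite ler_wpM2r // lerDl.
Qed.

Lemma precondE (v : Y) : M v = alpha *: A (AT v).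
Proof. by rewrite /precond scale_lfunE comp_lfunE. Qed.

Lemma precond_sym (u v : Y) : '[M u, v] = '[u, M v].
Proof. by rewrite !precondE innerZl innerZr A_adj (innerC u) A_adj innerC. Qed.

(** ['[M v, v]] equals [alpha] times the squared norm of [AT v], so the kernel is trivial, and
    equality of dimensions makes [M] surjective. *)
Lemma precondK (w : Y) : M ((M^-1)%VF w) = w.
Proof.
have kM : lker M == 0%VS.
  apply/lker0P => u v uv; apply/eqP; rewrite -subr_eq0; apply/eqP.
  have : '[M (u - v), u - v] = 0.
    move: uv; rewrite !precondE => uv.
    by rewrite (linearB AT) (linearB A) scalerBr /= uv subrr inner0l.
  rewrite precondE innerZl A_adj -sqr_norm_inner => /eqP.
  rewrite mulf_eq0 gt_eqF //= sqrf_eq0 normr_eq0 => /eqP.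
  exact: adjoint_inj.
apply: limg_lfunVK; suff -> : limg M = fullv by rewrite memvf.
apply/eqP; rewrite eqEdim subvf /= limg_dim_eq ?lexx //.
by rewrite (eqP kM) capv0.
Qed.

(** * Optimality conditions of one iteration *)

Lemma primal_step k :
  alpha *: AT (y k) = x k - x k.+1 - alpha *: gf (x k).
Proof.
have [-> _] := xy_PPDG k; apply: inner_inj => w.
by rewrite !innerE; ring.
Qed.

Lemma dual_step k : alpha *: AT (y k.+1 - y k) =
  (x k.+1 - x k) - (x k.+2 - x k.+1) - alpha *: (gf (x k.+1) - gf (x k)).
Proof.
rewrite linearB /= scalerBr !primal_step; apply: inner_inj => w.
by rewrite !innerE; ring.
Qed.

(** The subgradient [M (w - y k.+1)] at the proximal centre [w], expressed through the primal
    iterates alone. Indices are shifted by one so that a preceding iterate always exists. *)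
Definition dual_subgrad k : Y :=
  A (x k.+2 + alpha *: (gf (x k.+1) - gf (x k))).

Lemma dual_subgradP k : subdiff (conjugate h) (y k.+1) (dual_subgrad k).
Proof.
have [_ /(prox_subdiff h_gtNy h_dom precond_sym)] := xy_PPDG k.
congr (subdiff _ _ _).
set z := A (2 *: _ - _).
transitivity (M ((M^-1)%VF z) - M (y k.+1 - y k)).
  rewrite !precondE -scalerBr -(linearB A) -(linearB AT).
  by congr (_ *: A (AT _)); rewrite opprB addrCA addrA.
rewrite precondK precondE -linearZ dual_step -(linearB A); congr (A _).
by apply: inner_inj => w; rewrite !innerE; ring.
Qed.

(** Values start at [y 1], which is produced by a proximal step; at the arbitrary [y 0] the
    conjugate may be infinite. *)
Definition dual_val k : R := fine (conjugate h (y k.+1)).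

Lemma dual_valE k : conjugate h (y k.+1) = (dual_val k)%:E.
Proof. by have [hf _] := dual_subgradP k; rewrite fineK. Qed.

Lemma dual_val_le k z :
  ((dual_val k + '[dual_subgrad k, z - y k.+1])%:E <= conjugate h z)%E.
Proof. by have [_ /(_ z)] := dual_subgradP k; rewrite dual_valE. Qed.

(** * Descent of the Lyapunov function and size of its subdifferential *)

Definition Lyap_val k : R :=
  f (x k.+1) + '[y k.+1, A (x k.+1)] - dual_val k
  - a * `|x k.+1 - x k.+2| ^+ 2 + b * `|x k.+1 - x k| ^+ 2.

Definition Lyap_pt k : X * Y * X * X := (x k.+1, y k.+1, x k.+2, x k).

Lemma Lyap_valE k : Lyap f h A a b (Lyap_pt k) = (Lyap_val k)%:E.
Proof. by rewrite /Lyap /Lag /= dual_valE. Qed.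

Lemma Lyap_decrease k :
  Lyap_val k.+1 <= Lyap_val k
    - c * (`|x k.+2 - x k.+1| ^+ 2 + `|x k.+1 - x k| ^+ 2).
Proof.
have hf := descent_lemma f_grad gf_lip (x k.+1) (x k.+2 - x k.+1).
rewrite addrC subrK in hf.
have hH : dual_val k + '[dual_subgrad k, y k.+2 - y k.+1] <= dual_val k.+1.
  by have := dual_val_le k (y k.+2); rewrite dual_valE lee_fin.
have gf1 : `|gf (x k.+1) - gf (x k)| ^+ 2 <= L ^+ 2 * `|x k.+1 - x k| ^+ 2.
  by rewrite -exprMn ler_sqr ?nnegrE ?mulr_ge0 // ltW.
pose d1 := x k.+2 - x k.+1; pose d2 := x k.+3 - x k.+2.
(* [w] is the dual increment, pulled back by the adjoint and negated, seen as a combination of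
   primal steps; it is the factor of the cross term left by the subgradient inequality. *)
pose w := d2 - d1 + alpha *: (gf (x k.+2) - gf (x k.+1)).
have wE : w = - (alpha *: AT (y k.+2 - y k.+1)).
  by rewrite dual_step; apply: inner_inj => v; rewrite /w /d1 /d2 !innerE; ring.
have wle : `|w| ^+ 2 <= 2 * `|d2| ^+ 2 + 2 * ((1 + alpha * L) ^+ 2 * `|d1| ^+ 2).
  have -> : w = d2 + (alpha *: (gf (x k.+2) - gf (x k.+1)) - d1).
    by rewrite /w addrA addrAC.
  set q := _ - d1.
  have qle : `|q| ^+ 2 <= (1 + alpha * L) ^+ 2 * `|d1| ^+ 2.
    have q1 : 0 <= 1 + alpha * L by rewrite addr_ge0 // mulr_ge0 // ltW.
    rewrite -exprMn ler_sqr ?nnegrE ?mulr_ge0 //.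
    apply: le_trans (ler_normB _ _) _; rewrite normrZ gtr0_norm // mulrDl mul1r.
    by rewrite addrC lerD2l -mulrA ler_wpM2l // ltW.
  have := sqr_ge0 `|d2 - q|; rewrite sqr_normB sqr_normD; lra.
(* The weight [delta / alpha] gives the square of [d2] the coefficient [a], which cancels against
   the term [- a] of the next Lyapunov value. *)
have young := inner_le_sqr w (gf (x k.+1) - gf (x k)) (divr_gt0 delta_gt0 alpha_gt0).
have grad1 : '[gf (x k.+1), d1] = - alpha^-1 * `|d1| ^+ 2 - '[y k.+1, A d1].
  have E : '[alpha *: AT (y k.+1), d1] = '[- d1 - alpha *: gf (x k.+1), d1].
    by rewrite primal_step opprB.
  rewrite innerZl (innerC (AT _)) -A_adj (innerC (A _)) in E.
  rewrite innerDl !innerNl innerZl in E.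
  rewrite sqr_norm_inner.
  have -> : '[gf (x k.+1), d1] = alpha^-1 * (alpha * '[gf (x k.+1), d1]).
    by rewrite mulKf // gt_eqF.
  have -> : alpha * '[gf (x k.+1), d1] = - '[d1, d1] - alpha * '[y k.+1, A d1].
    lra.
  by field; rewrite gt_eqF.
have sE : '[dual_subgrad k, y k.+2 - y k.+1] =
    '[y k.+2 - y k.+1, A (x k.+2)] - '[w, gf (x k.+1) - gf (x k)].
  rewrite wE innerNl innerZl (innerC (AT _)) -A_adj /dual_subgrad.
  by rewrite A_adj innerDl innerZl -!A_adj (innerC (A (x k.+2))); ring.
(* The balance of all quadratic terms is an exact identity; the formulas for [b] and [c] are tuned
   to it. *)
have fin : (L / 2 - alpha^-1) * `|d1| ^+ 2
    + delta / alpha / 2 * (2 * `|d2| ^+ 2 + 2 * ((1 + alpha * L) ^+ 2 * `|d1| ^+ 2))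
    + (2 * (delta / alpha))^-1 * (L ^+ 2 * `|x k.+1 - x k| ^+ 2)
    - a * `|d2| ^+ 2 + b * `|d1| ^+ 2 =
    - c * (`|d1| ^+ 2 + `|x k.+1 - x k| ^+ 2) - a * `|d1| ^+ 2 + b * `|x k.+1 - x k| ^+ 2.
  rewrite /cst_c /cst_b /cst_a; field.
  by rewrite !gt_eqF.
have t0 : 0 <= delta / alpha / 2 by rewrite !mulr_ge0 ?invr_ge0 // ltW.
have u0 : 0 <= (2 * (delta / alpha))^-1.
  by rewrite invr_ge0 !mulr_ge0 ?invr_ge0 // ltW.
have h1 := ler_wpM2l t0 wle.
have h2 := ler_wpM2l u0 gf1.
have h3 : '[y k.+1, A d1] = '[y k.+1, A (x k.+2)] - '[y k.+1, A (x k.+1)].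
  by rewrite linearB /= !innerE.
have h4 : '[y k.+2 - y k.+1, A (x k.+2)] = '[y k.+2, A (x k.+2)] - '[y k.+1, A (x k.+2)].
  by rewrite !innerE.
rewrite /Lyap_val (distrC (x k.+1) (x k.+2)) (distrC (x k.+2) (x k.+3)).
rewrite -/d1 -/d2; rewrite -/d1 in hf.
lra.
Qed.

Definition step_size k : R := `|x k.+2 - x k.+1| + `|x k.+1 - x k|.

Lemma step_size_ge0 k : 0 <= step_size k.
Proof. by rewrite addr_ge0. Qed.

(** The lower bound on the adjoint turns [dual_step] into an estimate. Three consecutive primal
    increments occur, hence two consecutive values of [step_size]. *)
Lemma dual_step_bounded : exists2 K : R, 0 < K &
  forall k, `|y k.+2 - y k.+1| <= K * (step_size k + step_size k.+1).
Proof.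
have [C C0 hC] := adjoint_bounded_below.
exists (C * (alpha^-1 * (1 + alpha * L))).
  by rewrite !mulr_gt0 ?invr_gt0 // addr_gt0 // mulr_gt0.
move=> k; apply: le_trans (hC _) _; rewrite -!mulrA ler_pM2l //.
rewrite ler_pdivlMl //.
have := congr1 Num.norm (dual_step k.+1); rewrite normrZ gtr0_norm // => ->.
apply: le_trans (ler_normB _ _) _; rewrite normrZ gtr0_norm //.
apply: le_trans (lerD (ler_normB _ _) (ler_wpM2l (ltW alpha_gt0) (gf_lip _ _))) _.
rewrite /step_size mulrDl mul1r mulrA.
have aL : 0 <= alpha * L by rewrite mulr_ge0 // ltW.
have := normr_ge0 (x k.+1 - x k).
have := normr_ge0 (x k.+2 - x k.+1).
have := normr_ge0 (x k.+3 - x k.+2).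
set p := `|_|; set q := `|_|; set r := `|_|; nra.
Qed.

Lemma norm4_le (z : X * Y * X * X) :
  norm4 z <= `|z.1.1.1| + `|z.1.1.2| + `|z.1.2| + `|z.2|.
Proof.
case: z => [[[p q] r] s] /=.
rewrite -[leRHS]ger0_norm ?addr_ge0 // -sqrtr_sqr ler_wsqrtr //.
have := normr_ge0 p; have := normr_ge0 q; have := normr_ge0 r.
have := normr_ge0 s; nra.
Qed.

Lemma dLyap_dist_bounded : 0 < a -> 0 < b -> exists2 C : R, 0 < C &
  forall k, (dist0 norm4 (dLyap gf h A AT a b (Lyap_pt k)) <= (C * step_size k)%:E)%E.
Proof.
move=> a0 b0; have [CA CA0 hA] := linear_bounded A.
have aL : 0 < alpha * L by rewrite mulr_gt0.
have ai : 0 < alpha^-1 by rewrite invr_gt0.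
exists (alpha^-1 + 4 * a + 4 * b + CA * (1 + alpha * L)).
  have : 0 <= CA * (1 + alpha * L) by rewrite mulr_ge0 // addr_ge0 // ltW.
  lra.
move=> k; pose d1 := x k.+2 - x k.+1; pose d0 := x k.+1 - x k.
pose p1 : X := gf (x k.+1) + AT (y k.+1) - (2 * a) *: (x k.+1 - x k.+2)
  + (2 * b) *: (x k.+1 - x k).
pose p2 : Y := A (x k.+1) - dual_subgrad k.
pose p3 : X := (2 * a) *: (x k.+1 - x k.+2).
pose p4 : X := (2 * b) *: (x k - x k.+1).
have -> : (alpha^-1 + 4 * a + 4 * b + CA * (1 + alpha * L)) * step_size k
  = (alpha^-1 + 4 * a + 4 * b + CA * (1 + alpha * L)) * (`|d1| + `|d0|) by [].
apply: (@le_trans _ _ (norm4 (p1, p2, p3, p4))%:E).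
  apply: ereal_inf_lbound; exists (p1, p2, p3, p4) => //=.
  split=> //; split=> //; split=> //=.
  by exists (dual_subgrad k) => //; exact: dual_subgradP.
rewrite lee_fin; apply: le_trans (norm4_le _) _ => /=.
have n1 : `|p1| <= alpha^-1 * `|d1| + 2 * a * `|d1| + 2 * b * `|d0|.
  (* The primal update replaces [gf (x k.+1) + AT (y k.+1)] by [- alpha^-1 *: d1]. *)
  have -> : p1 = - (alpha^-1 *: d1) + (2 * a) *: d1 + (2 * b) *: d0.
    rewrite /p1; have -> : AT (y k.+1) = alpha^-1 *: (alpha *: AT (y k.+1)).
      by rewrite scalerA mulVf ?gt_eqF // scale1r.
    rewrite primal_step /d0 /d1.
    apply: inner_inj => w; rewrite !innerE; field.
    by rewrite gt_eqF.
  apply: le_trans (ler_normD _ _) _.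
  rewrite normrZ (@gtr0_norm _ (2 * b)) ?mulr_gt0 // lerD2r.
  apply: le_trans (ler_normD _ _) _.
  by rewrite normrN !normrZ !gtr0_norm // mulr_gt0.
have n2 : `|p2| <= CA * (`|d1| + alpha * L * `|d0|).
  rewrite /p2 /dual_subgrad -linearB; apply: le_trans (hA _) _.
  rewrite ler_wpM2l // opprD addrA.
  apply: le_trans (ler_normB _ _) _; rewrite distrC lerD2l normrZ gtr0_norm //.
  by rewrite -mulrA ler_pM2l.
have n3 : `|p3| = 2 * a * `|d1| by rewrite /p3 normrZ distrC gtr0_norm // mulr_gt0.
have n4 : `|p4| = 2 * b * `|d0| by rewrite /p4 normrZ distrC gtr0_norm // mulr_gt0.
rewrite n3 n4; have := normr_ge0 d1; have := normr_ge0 d0.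
move: n1 n2; set u := `|d1|; set v := `|d0| => n1 n2 v0 u0.
have : CA * (u + alpha * L * v) <= CA * ((1 + alpha * L) * (u + v)).
  by rewrite ler_wpM2l //; nra.
have : 0 <= a * v by rewrite mulr_ge0 // ltW.
have : 0 <= b * u by rewrite mulr_ge0 // ltW.
have : 0 <= alpha^-1 * v by rewrite mulr_ge0 // ltW.
lra.
Qed.

(** * Bounded iterates: convergence of the Lyapunov values and vanishing steps *)

Section Bounded.
Variable B : R.
Hypothesis x_le : forall k, `|x k| <= B.
Hypothesis y_le : forall k, `|y k| <= B.
Hypothesis a_gt0 : 0 < a.
Hypothesis b_gt0 : 0 < b.
Hypothesis c_gt0 : 0 < c.

Lemma Lyap_val_lbound : exists m, forall k, m <= Lyap_val k.
Proof.
have B0 : 0 <= B := le_trans (normr_ge0 _) (x_le 0).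
have [CA CA0 hA] := linear_bounded A.
have xB j k : `|x j - x k| <= 2 * B.
  by apply: le_trans (ler_normB _ _) _; have := x_le j; have := x_le k; lra.
pose G := `|gf 0| + L * B.
pose S := CA * (B + alpha * (L * (2 * B))).
exists (f 0 - G * B - L / 2 * B ^+ 2 - B * (CA * B) - dual_val 0 - S * (2 * B)
  - a * (2 * B) ^+ 2) => k.
(* The descent lemma from [x k.+1] to the origin bounds [f] below on the ball of radius [B]. *)
have hf : f 0 - G * B - L / 2 * B ^+ 2 <= f (x k.+1).
  have := descent_lemma f_grad gf_lip (x k.+1) (- x k.+1).
  rewrite subrr normrN innerNr => d.
  have gG : `|gf (x k.+1)| <= G.
    rewrite -[gf _](subrK (gf 0)) addrC; apply: le_trans (ler_normD _ _) _.
    rewrite lerD2l; apply: le_trans (gf_lip _ _) _.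
    by rewrite subr0 ler_pM2l.
  have := abs_inner_le (gf (x k.+1)) (x k.+1); rewrite ler_norml => /andP[i1 _].
  have : `|gf (x k.+1)| * `|x k.+1| <= G * B by rewrite ler_pM.
  have : L / 2 * `|x k.+1| ^+ 2 <= L / 2 * B ^+ 2.
    by rewrite ler_pM2l ?divr_gt0 // ler_sqr ?nnegrE.
  lra.
have hA1 : - (B * (CA * B)) <= '[y k.+1, A (x k.+1)].
  have := abs_inner_le (y k.+1) (A (x k.+1)); rewrite ler_norml => /andP[i1 _].
  apply: le_trans i1; rewrite lerN2 ler_pM //.
  by apply: le_trans (hA _) _; rewrite ler_wpM2l.
(* The subgradient inequality at [y k.+1], tested at the fixed point [y 1], bounds the conjugate
   values above because the subgradients are bounded. *)
have hH : dual_val k <= dual_val 0 + S * (2 * B).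
  have := dual_val_le k (y 1%N); rewrite dual_valE lee_fin.
  have := abs_inner_le (dual_subgrad k) (y 1%N - y k.+1).
  rewrite ler_norml => /andP[i1 _].
  have : `|dual_subgrad k| * `|y 1%N - y k.+1| <= S * (2 * B).
    rewrite ler_pM //.
      apply: le_trans (hA _) _; rewrite ler_wpM2l //.
      apply: le_trans (ler_normD _ _) _; rewrite lerD //.
      rewrite normrZ gtr0_norm // ler_pM2l //; apply: le_trans (gf_lip _ _) _.
      by rewrite ler_pM2l.
    by apply: le_trans (ler_normB _ _) _; have := y_le 1%N; have := y_le k.+1; lra.
  lra.
have ha : a * `|x k.+1 - x k.+2| ^+ 2 <= a * (2 * B) ^+ 2.
  by rewrite ler_pM2l // ler_sqr ?nnegrE // mulr_ge0.
have hb : 0 <= b * `|x k.+1 - x k| ^+ 2 by rewrite mulr_ge0 // ?ltW // exprn_ge0.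
rewrite /Lyap_val; lra.
Qed.

Lemma Lyap_val_step k :
  c / 2 * step_size k ^+ 2 <= Lyap_val k - Lyap_val k.+1.
Proof.
have := Lyap_decrease k; rewrite /step_size.
set u := `|_|; set v := `|_|.
have : 0 <= c / 2 * (u - v) ^+ 2 by rewrite mulr_ge0 ?sqr_ge0 // ltW // divr_gt0.
lra.
Qed.

Lemma Lyap_val_nonincreasing : nonincreasing_seq Lyap_val.
Proof.
apply/nonincreasing_seqP => k; rewrite -subr_ge0.
apply: le_trans (Lyap_val_step k).
by rewrite mulr_ge0 ?sqr_ge0 // ltW // divr_gt0.
Qed.

Lemma Lyap_val_cvg : cvgn Lyap_val.
Proof.
apply: nonincreasing_is_cvgn; first exact: Lyap_val_nonincreasing.
by have [m hm] := Lyap_val_lbound; exists m => _ [k _ <-].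
Qed.

Definition Lyap_lim : R := limn Lyap_val.

Lemma Lyap_lim_le k : Lyap_lim <= Lyap_val k.
Proof. exact: nonincreasing_cvgn_ge Lyap_val_nonincreasing Lyap_val_cvg k. Qed.

Lemma Lyap_gap_cvg : (fun k => Lyap_val k - Lyap_lim) @ \oo --> 0.
Proof. rewrite -(subrr Lyap_lim); apply: cvgB; [exact: Lyap_val_cvg|exact: cvg_cst]. Qed.

Lemma step_size_cvg : step_size @ \oo --> 0.
Proof.
apply/cvgrPdist_lt => e e0.
have ce : 0 < c / 2 * e ^+ 2 by rewrite mulr_gt0 ?exprn_gt0 // divr_gt0.
have [N hN] := cvgn_lt0 Lyap_gap_cvg ce.
exists N => // k /= /hN hk; rewrite sub0r normrN ger0_norm ?step_size_ge0 //.
rewrite -(@ltr_sqr R) ?nnegrE ?step_size_ge0 ?ltW //.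
rewrite -(@ltr_pM2l R (c / 2)) ?divr_gt0 //.
apply: le_lt_trans (Lyap_val_step k) _; have := Lyap_lim_le k.+1; lra.
Qed.


Lemma cluster_point : exists (sigma : nat -> nat) (xb : X) (yb : Y),
  [/\ forall j, (j <= sigma j)%N,
      (fun j => x (sigma j).+1) @ \oo --> xb
    & (fun j => y (sigma j).+1) @ \oo --> yb].
Proof.
have [s1 [xb [hs1 xs1]]] := bounded_cvg_subseq (fun k => x_le k.+1).
have [s2 [yb [hs2 ys2]]] := bounded_cvg_subseq (fun k => y_le (s1 k).+1).
exists (s1 \o s2), xb, yb; split => //.
  by move=> j; apply: leq_trans (hs2 j) (hs1 _).
exact: cvg_subseq hs2 xs1.
Qed.

(** * Criticality of cluster points *)

Section Cluster.
Variables (sigma : nat -> nat) (xb : X) (yb : Y).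
Hypothesis sigma_ge : forall j, (j <= sigma j)%N.
Hypothesis x_cvg : (fun j => x (sigma j).+1) @ \oo --> xb.
Hypothesis y_cvg : (fun j => y (sigma j).+1) @ \oo --> yb.
Hypothesis gf_cont : continuous gf.

Lemma step_subseq_cvg : (fun j => step_size (sigma j)) @ \oo --> 0.
Proof. exact: (cvg_subseq sigma_ge step_size_cvg). Qed.

Lemma next_step_cvg : (fun j => x (sigma j).+2 - x (sigma j).+1) @ \oo --> 0.
Proof.
by apply: (cvg_norm_le0 _ step_subseq_cvg) => j; rewrite /step_size lerDl.
Qed.

Lemma prev_step_cvg : (fun j => x (sigma j).+1 - x (sigma j)) @ \oo --> 0.
Proof.
by apply: (cvg_norm_le0 _ step_subseq_cvg) => j; rewrite /step_size lerDr.
Qed.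

Lemma dual_subgrad_cvg : (fun j => dual_subgrad (sigma j)) @ \oo --> A xb.
Proof.
have gfd : (fun j => gf (x (sigma j).+1) - gf (x (sigma j))) @ \oo --> 0.
  apply: (@cvg_norm_le0 _ _ _ (fun j => L * step_size (sigma j))).
    move=> j; apply: le_trans (gf_lip _ _) _.
    by rewrite ler_pM2l // /step_size lerDr.
  by rewrite -(mulr0 L); apply: cvgMl_tmp; exact: step_subseq_cvg.
apply: lfun_cvg.
have -> : xb = xb + 0 + alpha *: 0 by rewrite scaler0 !addr0.
apply: cvgD; last exact: cvgZl_tmp.
rewrite (_ : (fun j => _) =
    (fun j => x (sigma j).+1 + (x (sigma j).+2 - x (sigma j).+1))).
  exact: (cvgD x_cvg next_step_cvg).
by apply: funext => j; rewrite addrC subrK.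
Qed.

Lemma primal_critical : gf xb + AT yb = 0.
Proof.
have lhs : (fun j => gf (x (sigma j).+1) + AT (y (sigma j).+1)) @ \oo --> gf xb + AT yb.
  apply: cvgD; first exact: (cvg_comp _ _ x_cvg (@gf_cont xb)).
  exact: lfun_cvg.
suff rhs : (fun j => gf (x (sigma j).+1) + AT (y (sigma j).+1)) @ \oo --> (0 : X).
  exact: (cvg_unique (@norm_hausdorff _ _) lhs rhs).
apply: (@cvg_norm_le0 _ _ _ (fun j => alpha^-1 * step_size (sigma j))); last first.
  by rewrite -(mulr0 alpha^-1); apply: cvgMl_tmp; exact: step_subseq_cvg.
move=> j; rewrite ler_pdivlMl // -{1}(gtr0_norm alpha_gt0) -normrZ scalerDr.
rewrite primal_step addrCA subrr addr0.
by rewrite distrC lerDl.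
Qed.

(** The conjugate values are what remains of the convergent Lyapunov values once the continuous
    terms and the vanishing squares are removed. *)
Lemma dual_val_cvg : (fun j => dual_val (sigma j)) @ \oo -->
  f xb + '[yb, A xb] - Lyap_lim.
Proof.
have -> : (fun j => dual_val (sigma j)) = (fun j =>
    f (x (sigma j).+1) + '[y (sigma j).+1, A (x (sigma j).+1)]
    - (a * `|x (sigma j).+2 - x (sigma j).+1| ^+ 2)
    + (b * `|x (sigma j).+1 - x (sigma j)| ^+ 2) - Lyap_val (sigma j)).
  by apply: funext => j; rewrite /Lyap_val (distrC (x _.+2)); ring.
have sq0 (u : nat -> X) (t : R) : u @ \oo --> 0 ->
    (fun j => t * `|u j| ^+ 2) @ \oo --> 0.
  move=> u0; rewrite -(mulr0 t); apply: cvgMl_tmp.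
  rewrite (_ : 0 = `|0 : X| * `|0 : X|); last by rewrite normr0 mulr0.
  by under eq_fun do rewrite expr2; apply: cvgM; exact: cvg_norm.
have -> : f xb + '[yb, A xb] = f xb + '[yb, A xb] - 0 + 0 by rewrite subr0 addr0.
apply: cvgB; last exact: (cvg_subseq sigma_ge Lyap_val_cvg).
apply: cvgD; last exact: sq0 prev_step_cvg.
apply: cvgB; last exact: sq0 next_step_cvg.
apply: cvgD.
  apply: (cvg_comp _ _ x_cvg).
  by have [df _] := f_grad xb; exact: differentiable_continuous.
apply: cvg_inner y_cvg _.
exact: lfun_cvg.
Qed.

Let beta : R := f xb + '[yb, A xb] - Lyap_lim.

(** The subgradient inequalities pass to the limit, with [beta] standing for the value at [yb], not
    yet identified. *)
Lemma cluster_subgrad_le z :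
  ((beta + '[A xb, z - yb])%:E <= conjugate h z)%E.
Proof.
have := conjugate_gtNy h_dom z.
case hz : (conjugate h z) => [q| |] // _; last by rewrite leey.
rewrite lee_fin.
have lhs : (fun j => dual_val (sigma j) +
    '[dual_subgrad (sigma j), z - y (sigma j).+1]) @ \oo --> beta + '[A xb, z - yb].
  apply: cvgD; first exact: dual_val_cvg.
  apply: cvg_inner; first exact: dual_subgrad_cvg.
  by apply: cvgB => //; exact: cvg_cst.
apply: (ler_cvg_to lhs (cvg_cst q)).
by near=> j; have := dual_val_le (sigma j) z; rewrite hz lee_fin.
Unshelve. all: by end_near.
Qed.

(** Lower semicontinuity gives one inequality, and the limiting subgradient inequality at [z = yb]
    the other. *)
Lemma conjugate_cluster : conjugate h yb = beta%:E.
Proof.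
apply/eqP; rewrite eq_le; apply/andP; split.
  apply: (conjugate_cvg_le h_gtNy y_cvg dual_val_cvg) => k.
  by rewrite dual_valE.
by have := cluster_subgrad_le yb; rewrite subrr inner0r addr0.
Qed.

Lemma cluster_subgrad : subdiff (conjugate h) yb (A xb).
Proof.
split; first by rewrite conjugate_cluster.
by move=> z; rewrite conjugate_cluster; exact: cluster_subgrad_le.
Qed.

Lemma Lyap_cluster : Lyap f h A a b (xb, yb, xb, xb) = Lyap_lim%:E.
Proof.
rewrite /Lyap /Lag conjugate_cluster subrr normr0 expr0n /= !mulr0 /beta.
by rewrite -!EFinB -EFinD; congr (_%:E); ring.
Qed.


(** * The KL argument: finite length and convergence of the whole sequence *)

Hypothesis Lyap_KL :
  KL_at norm4 (Lyap f h A a b) (dLyap gf h A AT a b) (xb, yb, xb, xb).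

Lemma iterates_converge :
  [/\ (fun k => x k.+1) @ \oo --> xb, (fun k => y k.+1) @ \oo --> yb
    & exists S, forall n, \sum_(0 <= k < n) step_size k <= S].
Proof.
have [eta [U [phi [eta0 zbU des KLU]]]] := Lyap_KL.
have [C C0 hC] := dLyap_dist_bounded a_gt0 b_gt0.
have [K K0 hK] := dual_step_bounded.
pose D k := `|xb - x k.+1| + `|yb - y k.+1|.
pose gap k := Lyap_val k - Lyap_lim.
have gap0 k : 0 <= gap k by rewrite subr_ge0 Lyap_lim_le.
(* The last two components of [Lyap_pt k] differ from [x k.+1] by one step each, so
   [D k + step_size k] controls all four distances. *)
have [r r0 hr] : exists2 r, 0 < r & forall k, D k + step_size k < r -> U (Lyap_pt k).
  have /nbhs_ballP[r r0 hr] := zbU; exists r => // k Dk; apply: hr.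
  have := normr_ge0 (xb - x k.+1); have := normr_ge0 (yb - y k.+1).
  have := normr_ge0 (x k.+2 - x k.+1); have := normr_ge0 (x k.+1 - x k).
  have := ler_normB (xb - x k.+1) (x k.+2 - x k.+1); rewrite opprB addrA subrK.
  have := ler_normD (xb - x k.+1) (x k.+1 - x k); rewrite addrA subrK.
  move: Dk; rewrite /D /step_size => *.
  by do 3?split; rewrite /= -ball_normE /=; lra.
have [N hN] : exists N, forall k, (N <= k)%N -> ((gap k)%:E < eta)%E.
  case: eta eta0 {des KLU} => [t| |] // t0.
    by have [N hN] := cvgn_lt0 Lyap_gap_cvg t0; exists N => k /hN; rewrite lte_fin.
  by exists 0%N => k _; exact: ltry.
have [phi_ge0 phi0 phi_cont _ dphi] := des.
have gap_in k : (N <= k)%N -> gap k \in co_itv eta by move=> /hN ?; rewrite inE.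
have phi_cvg : (fun k => phi (gap k)) @ \oo --> 0.
  rewrite -phi0; have /subspace_continuousP/(_ 0) := phi_cont.
  have in0 : co_itv eta 0 by [].
  move=> /(_ in0) c0; apply: (cvg_comp _ _ _ c0).
  move=> P hP; have [m _ hm] := Lyap_gap_cvg hP.
  exists (maxn N m) => // k /=; rewrite geq_max => /andP[Nk mk].
  by apply: (hm k mk); have := gap_in k Nk; rewrite inE.
have desc k : (N <= k)%N -> D k + step_size k < r ->
    c / (2 * C) * step_size k <= phi (gap k) - phi (gap k.+1).
  move=> Nk Dk; have stp := Lyap_val_step k.
  have gap_step : c / 2 * step_size k ^+ 2 <= gap k - gap k.+1.
    by rewrite /gap opprB addrA subrK.
  (* The KL inequality is silent at gap zero; there the next gap vanishes too, and the quadratic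
     decrease forces a zero step. *)
  have [gk|gk] := eqVneq (gap k) 0.
    have gk1 : gap k.+1 = 0.
      apply/eqP; rewrite eq_le gap0 andbT -gk -subr_ge0; apply: le_trans gap_step.
      by rewrite mulr_ge0 ?sqr_ge0 // ltW // divr_gt0.
    have : step_size k ^+ 2 <= 0.
      rewrite gk gk1 subrr in gap_step.
      by rewrite -(pmulr_rle0 _ (divr_gt0 c_gt0 (ltr0n _ 2))).
    rewrite gk gk1 subrr real_exprn_even_le0 ?num_real //= => /eqP ->.
    by rewrite mulr0.
  have gpos : 0 < gap k by rewrite lt_neqAle eq_sym gk gap0.
  have [_ _ dpos] := dphi _ gpos (hN k Nk).
  have := desingularizing_concave_le des (gap0 k.+1) _ gpos (hN k Nk).
  have -> : gap k.+1 <= gap k.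
    rewrite -subr_ge0; apply: le_trans gap_step.
    by rewrite mulr_ge0 ?sqr_ge0 // ltW // divr_gt0.
  move=> /(_ isT); apply: le_trans.
  (* With the distance bounded by [C * step_size k], the KL inequality yields
     [phi' (gap k) * C * step_size k >= 1], which converts the quadratic decrease into a linear one
     with constant [c / (2 * C)]. *)
  have := KLU _ (hr k Dk); rewrite Lyap_valE Lyap_cluster -EFinB -/(gap k) /=.
  move=> /(_ gpos (hN k Nk)) one_le.
  have {one_le} : 1 <= derive1 phi (gap k) * (C * step_size k).
    rewrite -lee_fin EFinM; apply: le_trans one_le _.
    by apply: lee_wpmul2l; [rewrite lee_fin ltW|exact: hC].
  move=> one_le.
  apply: le_trans (ler_wpM2l (ltW dpos) gap_step).
  have se : 0 <= c / (2 * C) * step_size k.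
    by rewrite mulr_ge0 ?step_size_ge0 // ltW // divr_gt0 // mulr_gt0.
  have := ler_wpM2l se one_le; rewrite mulr1 => /le_trans; apply.
  rewrite le_eqVlt; apply/orP; left; apply/eqP; field.
  by rewrite gt_eqF.
have [Dcv Scv] : D @ \oo --> 0 /\ exists S, forall n, \sum_(0 <= k < n) step_size k <= S.
  (* In [K + 1], the 1 pays for the primal increment and [K] for the dual one. *)
  apply: (descent_trap (K := K + 1) _ _ r0 step_size_ge0 _ _ step_size_cvg
    phi_cvg _ desc).
  - exact: addr_gt0.
  - by rewrite divr_gt0 // mulr_gt0.
  - by move=> k; rewrite addr_ge0.
  - by move=> k Nk; apply: phi_ge0; exact: gap_in.
  - move=> k; have := hK k; have := step_size_ge0 k.+1.
    have := ler_normB (xb - x k.+1) (x k.+2 - x k.+1); rewrite opprB addrA subrK.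
    have := ler_normB (yb - y k.+1) (y k.+2 - y k.+1); rewrite opprB addrA subrK.
    have := normr_ge0 (x k.+1 - x k).
    rewrite /D /step_size; lra.
  - move=> eps n eps0.
    have Dsig : (fun j => D (sigma j)) @ \oo --> 0.
      rewrite -(addr0 0); apply: cvgD.
        rewrite -(normr0 X) -(subrr xb); apply: cvg_norm.
        by apply: cvgB => //; exact: cvg_cst.
      rewrite -(normr0 Y) -(subrr yb); apply: cvg_norm.
        by apply: cvgB => //; exact: cvg_cst.
    have [m hm] := cvgn_lt0 Dsig eps0.
    exists (sigma (maxn n m)); last by apply: hm; exact: leq_maxr.
    exact: leq_trans (leq_maxl n m) (sigma_ge _).
split => //; apply/cvgrPdist_lt => eps eps0.
  have [m hm] := cvgn_lt0 Dcv eps0; exists m => // k /= /hm.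
  by apply: le_lt_trans; rewrite lerDl.
have [m hm] := cvgn_lt0 Dcv eps0; exists m => // k /= /hm.
by apply: le_lt_trans; rewrite lerDr.
Qed.

End Cluster.

Lemma PPDG_converges : continuous gf ->
  KL_function norm4 (Lyap f h A a b) (dLyap gf h A AT a b) ->
  exists2 p : X * Y, crit_Lag gf h A AT p &
    [/\ (fun k => x k.+1) @ \oo --> p.1, (fun k => y k.+1) @ \oo --> p.2
      & exists S, forall n, \sum_(0 <= k < n) step_size k <= S].
Proof.
move=> gf_cont KL.
have [sigma [xb [yb [sigma_ge x_cvg y_cvg]]]] := cluster_point.
have sg := cluster_subgrad sigma_ge x_cvg y_cvg.
exists (xb, yb) => /=.
  split => /=; first by rewrite (primal_critical sigma_ge x_cvg y_cvg gf_cont).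
  by exists (A xb) => //; rewrite subrr.
apply: (iterates_converge sigma_ge x_cvg y_cvg); apply: KL.
(* An element of the subdifferential at the cluster point, built on the subgradient [A xb], so that
   the KL property is available there. *)
exists (gf xb + AT yb - (2 * a) *: (xb - xb) + (2 * b) *: (xb - xb),
  A xb - A xb, (2 * a) *: (xb - xb), (2 * b) *: (xb - xb)).
by split => //; split => //; split => //=; exists (A xb).
Qed.

End Bounded.
End PPDG.

Theorem theorem2p9 (R : realType) (X Y : euclideanType R)
  (f : X -> R) (gf : X -> X) (h : Y -> \bar R)
  (A : 'Hom(X, Y)) (AT : 'Hom(Y, X))
  (L alpha delta : R) (x : nat -> X) (y : nat -> Y)
  (f_grad : is_gradient f gf) (gf_cont : continuous gf)
  (h_gtNy : forall u, (-oo < h u)%E)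
  (A_adj : is_adjoint A AT)
  (L_gt0 : 0 < L)
  (A1 : forall u v, `|gf u - gf v| <= L * `|u - v|)
  (A2 : forall w, (conjugate h w < +oo)%E ->
          (-oo < ereal_inf [set Lag f h A u w | u in [set: X]])%E)
  (A3 : forall w, exists u, A u = w)
  (A4 : proper_fun (conv_fun h))
  (alpha_gt0 : 0 < alpha) (delta_gt0 : 0 < delta)
  (a_gt0 : 0 < cst_a alpha delta)
  (b_gt0 : 0 < cst_b alpha L delta)
  (c_gt0 : 0 < cst_c alpha L delta)
  (xy_PPDG : PPDG gf h A AT alpha x y)
  (Lyap_KL : KL_function norm4
     (Lyap f h A (cst_a alpha delta) (cst_b alpha L delta))
     (dLyap gf h A AT (cst_a alpha delta) (cst_b alpha L delta)))
  (xy_bounded : bounded_set (range (fun k => (x k, y k)))) :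
  [/\ exists2 p : X * Y, crit_Lag gf h A AT p
        & (fun k => (x k, y k)) @ \oo --> p,
      (\sum_(1 <= k <oo) (`|x k.+1 - x k|)%:E < +oo)%E
    & (\sum_(1 <= k <oo) (`|y k.+1 - y k|)%:E < +oo)%E].
Proof.
have h_dom := proper_conv_fun_dom h_gtNy A4.
have [B hB] : exists B, forall k, `|(x k, y k)| <= B.
  have [M [_ hM]] := xy_bounded; exists (M + 1) => k.
  by apply: hM; [rewrite ltrDl|exists k].
have xB k : `|x k| <= B by apply: le_trans (hB k); rewrite [leRHS]prod_normE le_max lexx.
have yB k : `|y k| <= B.
  by apply: le_trans (hB k); rewrite [leRHS]prod_normE le_max lexx orbT.
have [p crit [x_cvg y_cvg [S hS]]] := PPDG_converges f_grad h_gtNy h_dom A_adj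
  L_gt0 A1 A3 alpha_gt0 delta_gt0 xy_PPDG xB yB a_gt0 b_gt0 c_gt0 gf_cont Lyap_KL.
have [K K_gt0 hK] := dual_step_bounded A_adj L_gt0 A1 A3 alpha_gt0 xy_PPDG.
split.
- exists p => //; rewrite [p]surjective_pairing; apply: cvg_pair => /=.
    by rewrite -cvg_shiftS; exact: x_cvg.
  by rewrite -cvg_shiftS; exact: y_cvg.
- apply: (@bounded_partial_sums_nneseries _ (fun k => `|x k.+1 - x k|) S) => // n.
  by apply: le_trans (hS n); apply: ler_sum => k _; rewrite lerDr.
(* The estimate on dual steps starts at [y 2 - y 1], so the first increment is split off; each half
   of the estimate sums to at most [S]. *)
- apply: (@bounded_partial_sums_nneseries _ (fun k => `|y k.+1 - y k|)
    (`|y 1%N - y 0%N| + K * (S + S))) => // n.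
  apply: (@le_trans _ _ (\sum_(0 <= k < n.+1) `|y k.+1 - y k|)).
    by rewrite big_nat_recr //= lerDl.
  rewrite big_nat_recl //= lerD2l.
  apply: (@le_trans _ _ (\sum_(0 <= k < n) K * (step_size x k + step_size x k.+1))).
    by apply: ler_sum => k _; exact: hK.
  rewrite -mulr_sumr ler_pM2l // big_split /= lerD //.
  apply: le_trans (hS n.+1); rewrite [leRHS]big_nat_recl //= lerDr.
  exact: step_size_ge0.
Qed.
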